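(* Let $d,\ell,k\geq1$ be integers, let $v_1,\dots,v_\ell\in\mathbb{Z}^d$, and let $P_1,\dots,P_\ell\in\mathbb{Z}[r]$ with $\max_{1\leq j\leq\ell}\deg P_j\leq k$. There exists a constant $C$ (depending on the $v_j$ and $P_j$) such that if $N$ is a positive integer and $A\subseteq[1,N]^d$ with \[\frac{|A|}{N^d}\geq C\,N^{-1/(\ell k)},\] then there exist $r',r''\in\mathbb{N}$ with $r'\neq r''$ such that \[\bigl\{(P_1(r')-P_1(r''))v_1,\dots,(P_\ell(r')-P_\ell(r''))v_\ell\bigr\}\subseteq A-A.\]
   Context: $[1,N]=\{1,\dots,N\}$ and $[1,N]^d$ its $d$-fold product; $A-A=\{a-a':a,a'\in A\}$. *)

(* Defs.v *)
From HB Require Import structures.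
From mathcomp Require Export all_boot all_order all_algebra finmap.
From mathcomp Require Export reals exp.
Export Order.TTheory GRing.Theory Num.Theory.
Set Implicit Arguments.
Unset Strict Implicit.
Unset Printing Implicit Defensive.

Local Open Scope ring_scope.
Local Open Scope fset_scope.

Definition cube (d N : nat) : {pred 'rV[int]_d} :=
  fun a => [forall i : 'I_d, 1 <= a ord0 i <= N%:Z].
Arguments cube : clear implicits.

Definition diffset (d : nat) (A : {fset 'rV[int]_d}) : {fset 'rV[int]_d} :=
  [fset a - a' | a in A, a' in A].

(* The zero polynomial is given degree 0. *)
Definition deg (p : {poly int}) : nat := (size p).-1.

(* Main.v *)
Require Import Defs.
From mathcomp Require Import zify ring lra.
Local Open Scope ring_scope.

(** Translate the [l]-fold product of [A] by the vectors
    [(P_1(r) v_1, ..., P_l(r) v_l)] for [1 <= r <= M], where [M] is the integer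
    part of [N^(1/k)].  Since [M^k <= N], all translates lie in a box of volume
    [O(N^(d l))], while the density hypothesis makes [M |A|^l] larger than that
    volume.  Hence two translates meet, and comparing the coordinates of a
    common point gives the inclusion into [A - A]. *)

Lemma horner_norm_le (p : {poly int}) (k r : nat) :
  (deg p <= k)%N -> (0 < r)%N ->
  `|p.[r%:Z]| <= (\sum_(i < size p) `|p`_i|) * r%:Z ^+ k.
Proof.
move=> pk r0; rewrite horner_coef mulr_suml.
apply: le_trans (ler_norm_sum _ _ _) _; apply: ler_sum => i _.
rewrite normrM ler_wpM2l // normrX ger0_norm //.
apply: ler_weXn2l; first by lia.
by move: pk (ltn_ord i); rewrite /deg; lia.
Qed.

Lemma nat_root_exists (k N : nat) :
  (0 < k)%N -> exists M, (M ^ k <= N < M.+1 ^ k)%N.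
Proof.
move=> k0; elim: N => [|N [M /andP[lo hi]]].
  by exists 0; rewrite exp0n // exp1n.
have [h|h] := ltnP N.+1 (M.+1 ^ k); first by exists M; rewrite h leqW.
exists M.+1; rewrite h /=; apply: leq_ltn_trans hi _.
by rewrite ltn_exp2r.
Qed.

Lemma translates_meet (d l M W : nat) (A : {fset 'rV[int]_d})
    (w : nat -> 'I_l -> 'rV[int]_d) (s : int) :
  (0 < W)%N ->
  (forall (r : nat) (a : 'rV[int]_d) j i, (r < M)%N -> a \in A ->
     0 <= a ord0 i + w r j ord0 i + s < W%:Z) ->
  ((W ^ d) ^ l < M * #|` A| ^ l)%N ->
  exists r r' : nat, r <> r' /\ forall j, w r j - w r' j \in diffset A.
Proof.
case: W => // W _ bnd big.
pose f (x : 'I_M * {ffun 'I_l -> A}) : {ffun 'I_l -> {ffun 'I_d -> 'I_W.+1}} :=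
  [ffun j => [ffun i =>
    inord (absz (val (x.2 j) ord0 i + w x.1 j ord0 i + s))]].
have : ~~ injectiveb f.
  apply: contraL big => /injectiveP /leq_card.
  by rewrite card_prod !card_ffun !card_ord -cardfE -leqNgt.
case/injectivePn => -[r a] [[r' a'] ne /ffunP eqf].
(* [absz] forgets signs and [inord] sends out-of-range values to a default, so a collision of [f] is
   a genuine equality only because [bnd] keeps the coordinates in range. *)
have inord_inj (x y : int) : 0 <= x < W.+1%:Z -> 0 <= y < W.+1%:Z ->
    inord (absz x) = inord (absz y) :> 'I_W.+1 -> x = y.
  by move=> hx hy /(congr1 val); rewrite /= !inordK; lia.
have eqw j : val (a j) + w r j = val (a' j) + w r' j.
  apply/rowP => i; rewrite [LHS]mxE [RHS]mxE; apply: (addIr s).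
  apply: inord_inj; [exact: bnd (valP _) | exact: bnd (valP _) |].
  by have /ffunP/(_ i) := eqf j; rewrite !ffunE.
exists r, r'; split.
  (* With equal indices the translation cancels, so the two tuples would coincide too, against the
     choice of distinct pairs. *)
  move=> err; have er : r = r' by apply: val_inj.
  case/eqP: ne; congr pair => //; apply/ffunP => j; apply: val_inj.
  by move: (eqw j); rewrite er => /addIr.
move=> j; have -> : w r j - w r' j = val (a' j) - val (a j).
  by apply/eqP; rewrite subr_eq addrAC eq_sym subr_eq -eqw addrC.
by apply: in_imfset2; apply: valP.
Qed.

(** With [t] the power of [N] and [V = (K * N) ^ d], comparing [k]-th powers gives
    [t ^+ l >= 1 / (M + 1)], hence [M * t ^+ l >= 1/2]. The factor 4 pays for this rounding loss:
    [4 ^+ l >= 4], so [M * c ^ l] is at least [2 * V ^+ l]. *)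
Lemma density_volume_lt (R : realType) (d l k K M N c : nat) :
  (0 < l)%N -> (0 < k)%N -> (0 < K)%N -> (0 < N)%N -> (0 < M)%N ->
  (N < M.+1 ^ k)%N ->
  4 * K%:R ^+ d * (N%:R : R) `^ (- (1 / (l * k)%:R)) <= c%:R / N%:R ^+ d ->
  (((K * N) ^ d) ^ l < M * c ^ l)%N.
Proof.
move=> l0 k0 K0 N0 M0 NM.
set t := _ `^ _ => dens.
have NR : 0 < N%:R :> R by rewrite ltr0n.
have KR : 0 < K%:R :> R by rewrite ltr0n.
have t0 : 0 < t by apply: powR_gt0.
have tlk : (t ^+ l) ^+ k = N%:R^-1.
  rewrite -exprM -powR_mulrn ?ltW // -powRrM mulNr div1r mulVf ?powR_inv1 ?ltW //.
  by rewrite pnatr_eq0; lia.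
have tl : M.+1%:R^-1 <= t ^+ l.
  rewrite -(@ler_pXn2r _ k) ?nnegrE ?invr_ge0 ?exprn_ge0 ?ltW //.
  by rewrite tlk exprVn ltf_pV2 ?posrE ?exprn_gt0 ?ltr0n // -natrX ltr_nat.
have {}dens : 4 * (K%:R * N%:R) ^+ d * t <= c%:R.
  by move: dens; rewrite ler_pdivlMr ?exprn_gt0 // exprMn; apply: le_trans; 
     rewrite le_eqVlt; apply/orP; left; apply/eqP; ring.
set V := (K%:R * N%:R) ^+ d in dens.
have V0 : 0 < V by rewrite exprn_gt0 // mulr_gt0.
have {}dens : 4 ^+ l * V ^+ l * t ^+ l <= c%:R ^+ l.
  by rewrite -!exprMn lerXn2r // nnegrE // !mulr_ge0 // ltW.
rewrite -(ltr_nat R) !(natrX, natrM) -/V.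
have Vl0 : 0 < V ^+ l by rewrite exprn_gt0.
have four : 4 <= 4 ^+ l :> R by rewrite -[X in X <= _]expr1 ler_weXn2l // ler1n.
have half : 2^-1 <= M%:R * t ^+ l.
  apply: le_trans (_ : M%:R * M.+1%:R^-1 <= _); last by rewrite ler_wpM2l.
  rewrite ler_pdivlMr ?ltr0n // -[M.+1]addn1 natrD.
  have : 1 <= M%:R :> R by rewrite ler1n.
  lra.
apply: lt_le_trans (_ : M%:R * (4 ^+ l * V ^+ l * t ^+ l) <= _);
  last by rewrite ler_wpM2l.
rewrite (_ : _ * _ = (4 ^+ l * (M%:R * t ^+ l)) * V ^+ l); last by ring.
rewrite ltr_pMl //; nra.
Qed.

Local Open Scope fset_scope.

Theorem theorem3p2 (R : realType) (d l k : nat)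
    (hd : (1 <= d)%N) (hl : (1 <= l)%N) (hk : (1 <= k)%N)
    (v : 'I_l -> 'rV[int]_d) (P : 'I_l -> {poly int})
    (hP : (\max_(j < l) deg (P j) <= k)%N) :
  exists C : R,
    forall (N : nat) (A : {fset 'rV[int]_d}),
      (0 < N)%N ->
      {subset A <= cube d N} ->
      (#|` A|)%:R / N%:R ^+ d >= C * N%:R `^ (- (1 / (l * k)%:R)) ->
      exists r' r'' : nat,
        [/\ (0 < r')%N, (0 < r'')%N, r' <> r'' &
            [fset ((P j).[r'%:Z] - (P j).[r''%:Z]) *: v j | j : 'I_l]
              `<=` diffset A].
Proof.
pose S j : int := \sum_(i < size (P j)) `|(P j)`_i|.
(* Summing over all [j] and [i] gives one bound: every coordinate of every translation vector will
   be at most [B * N] in absolute value. *)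
pose B : nat := `|\sum_j \sum_i S j * `|v j ord0 i| : int|%N.
have S0 j : 0 <= S j by apply: sumr_ge0.
have SvB j i : S j * `|v j ord0 i| <= B%:Z.
  rewrite /B gez0_abs; last first.
    by do 2![apply: sumr_ge0 => ? _]; rewrite mulr_ge0.
  rewrite (bigD1 j) //= (bigD1 i) //= -addrA lerDl addr_ge0 //.
    by apply: sumr_ge0 => ? _; rewrite mulr_ge0.
  by do 2![apply: sumr_ge0 => ? _]; rewrite mulr_ge0.
(* Shifted by [B * N], the coordinates lie in [[0, N + 2 * B * N]]; replacing [N] by [2 * N] makes
   the upper bound strict and keeps it a multiple of [N]. *)
pose K := (2 + 2 * B)%N.
exists (4 * K%:R ^+ d) => N A N0 AN dens.
have [M /andP[MN NM]] := nat_root_exists k N hk.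
have M0 : (0 < M)%N.
  by rewrite lt0n; apply: contraTneq NM => ->; rewrite exp1n -leqNgt.
have big : (((K * N) ^ d) ^ l < M * #|` A| ^ l)%N.
  exact: density_volume_lt dens.
(* Indices [r < M] stand for the arguments [r.+1] in [[1, M]]: these are positive, and
   [r.+1 ^ k <= M ^ k <= N] bounds the polynomial values. *)
have [||r [r' [ne sub]]] :=
    @translates_meet d l M _ A (fun r j => (P j).[r.+1%:Z] *: v j)
      (B * N)%N%:Z _ _ big.
- by rewrite muln_gt0.
- move=> r a j i rM aA.
  have /forallP/(_ i) := AN _ aA.
  rewrite mxE => aN.
  have : `|(P j).[r.+1%:Z] * v j ord0 i| <= (B * N)%N%:Z.
    have degk : (deg (P j) <= k)%N by apply: leq_trans hP; apply: leq_bigmax.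
    rewrite normrM.
    apply: le_trans (_ : S j * `|v j ord0 i| * N%:Z <= _); last first.
      by rewrite PoszM ler_wpM2r.
    rewrite mulrAC ler_wpM2r //.
    apply: le_trans (horner_norm_le _ k _ degk (ltn0Sn r)) _.
    rewrite ler_wpM2l ?S0 // -[N%:Z]natz -[r.+1%:Z]natz -natrX ler_nat.
    by apply: leq_trans MN; rewrite leq_exp2r.
  rewrite ler_norml => zB.
  have box (x y z : int) : 1 <= x <= N%:Z -> - y <= z <= y ->
      (0 <= x + z + y < 2 * N%:Z + 2 * y)%R by lia.
  by rewrite (_ : (K * N)%N%:Z = (2 * N%:Z + 2 * (B * N)%N%:Z)%R) ?box // /K; lia.
exists r.+1, r'.+1; split=> // [[]//|].
apply/fsubsetP => x /imfsetP[j _ ->].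
by rewrite scalerBl; apply: sub.
Qed.
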